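(* Let $\mathcal{H}$ be the hypothesis class of ReLU neural networks with $W$ parameters, where each parameter is represented by $B$ bits. Then the VC dimension of $\mathcal{H}$ is $O(WB+W\log(W))$.
   Context: $\log$ is the base-2 logarithm and $O(\cdot)$ hides constant factors. $\sigma(z)=\max\{0,z\}$ is the ReLU function, applied coordinatewise to vectors. With $d\in\mathbb{N}$ the input dimension, a ReLU neural network of depth $L$ is a function $\mathcal{N}:\mathbb{R}^d\to\mathbb{R}$ computed by $\mathbf{h}^{(1)}=\sigma(W^{(1)}\mathbf{x}+\mathbf{b}^{(1)})$ with $W^{(1)}\in\mathbb{R}^{m_1\times d}$, $\mathbf{b}^{(1)}\in\mathbb{R}^{m_1}$; $\mathbf{h}^{(i)}=\sigma(W^{(i)}\mathbf{h}^{(i-1)}+\mathbf{b}^{(i)})$ with $W^{(i)}\in\mathbb{R}^{m_i\times m_{i-1}}$, $\mathbf{b}^{(i)}\in\mathbb{R}^{m_i}$ for $i=2,\dots,L-1$; and $\mathcal{N}(\mathbf{x})=W^{(L)}\mathbf{h}^{(L-1)}+\mathbf{b}^{(L)}$ with $W^{(L)}\in\mathbb{R}^{1\times m_{L-1}}$, $\mathbf{b}^{(L)}\in\mathbb{R}$. The number of parameters of the network is the number of its weights which are non-zero; it corresponds to the number of edges when the network is viewed as a directed acyclic graph. ''Represented by $B$ bits'' means that $B$ bits are used to encode the value of each weight, so each weight takes one of at most $2^B$ values. A class $\mathcal{H}$ shatters points $\mathbf{x}_1,\dots,\mathbf{x}_N$ if for every $y_1,\dots,y_N\in\{\pm1\}$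 there is $h\in\mathcal{H}$ with $h(\mathbf{x}_i)=y_i$ for all $i$; the VC dimension is the largest size of a shattered set. *)

(* Defs.v *)
From HB Require Import structures.
From mathcomp Require Import all_boot all_order all_algebra.
From mathcomp Require Import all_classical all_reals all_analysis.

Set Implicit Arguments.
Unset Strict Implicit.
Unset Printing Implicit Defensive.
Import Order.TTheory GRing.Theory Num.Theory.
Local Open Scope classical_set_scope.
Local Open Scope ring_scope.

Definition log2 (R : realType) (x : R) : R := ln x / ln 2.

Definition relu (R : realType) (z : R) : R := Num.max 0 z.

Record affine (R : realType) (n m : nat) := Affine {
  weight : 'M[R]_(m, n);
  bias : 'cV[R]_m }.

Definition affine_eval (R : realType) (n m : nat) (l : affine R n m)
  (x : 'cV[R]_n) : 'cV[R]_m := weight l *m x + bias l.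

(* [hidden R d m]: one or more hidden layers on inputs in R^d, the last of
   which has width m. *)
Inductive hidden (R : realType) (d : nat) : nat -> Type :=
| FirstLayer m of affine R d m : hidden R d m
| NextLayer n m of hidden R d n & affine R n m : hidden R d m.

Fixpoint hidden_eval (R : realType) (d m : nat) (h : hidden R d m)
    (x : 'cV[R]_d) : 'cV[R]_m :=
  match h with
  | FirstLayer _ l => map_mx (@relu R) (affine_eval l x)
  | NextLayer _ _ h' l => map_mx (@relu R) (affine_eval l (hidden_eval h' x))
  end.

(* L - 1 hidden layers followed by an affine output layer, so the depth L is an
   arbitrary integer >= 2 and the widths are arbitrary. *)
Record relu_net (R : realType) (d : nat) := ReluNet {
  last_width : nat;
  hidden_layers : hidden R d last_width;
  output_layer : affine R last_width 1 }.

Definition net_eval (R : realType) (d : nat) (N : relu_net R d)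
  (x : 'cV[R]_d) : R :=
  affine_eval (output_layer N) (hidden_eval (hidden_layers N) x) ord0 ord0.

(* The number of edges of a layer.  Biases are not edges and are not counted. *)
Definition affine_size (R : realType) (n m : nat) (l : affine R n m) : nat :=
  #|[set ij : 'I_m * 'I_n | weight l ij.1 ij.2 != 0]%SET|.

Fixpoint hidden_size (R : realType) (d m : nat) (h : hidden R d m) : nat :=
  match h with
  | FirstLayer _ l => affine_size l
  | NextLayer _ _ h' l => (hidden_size h' + affine_size l)%N
  end.

Definition net_size (R : realType) (d : nat) (N : relu_net R d) : nat :=
  (hidden_size (hidden_layers N) + affine_size (output_layer N))%N.

(* [dec] decodes B-bit words into reals.  A zero entry stands for an absent
   weight or bias and needs no code word. *)
Definition encodable (R : realType) (B : nat) (dec : B.-tuple bool -> R)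
  (a : R) : Prop := a = 0 \/ exists w, a = dec w.

Definition affine_encodable (R : realType) (B : nat)
  (dec : B.-tuple bool -> R) (n m : nat) (l : affine R n m) : Prop :=
  (forall i j, encodable dec (weight l i j)) /\
  (forall i j, encodable dec (bias l i j)).

Fixpoint hidden_encodable (R : realType) (B : nat)
    (dec : B.-tuple bool -> R) (d m : nat) (h : hidden R d m) : Prop :=
  match h with
  | FirstLayer _ l => affine_encodable dec l
  | NextLayer _ _ h' l => hidden_encodable dec h' /\ affine_encodable dec l
  end.

Definition net_encodable (R : realType) (B : nat)
  (dec : B.-tuple bool -> R) (d : nat) (N : relu_net R d) : Prop :=
  hidden_encodable dec (hidden_layers N) /\
  affine_encodable dec (output_layer N).

Definition relu_class (R : realType) (d W B : nat)
  (dec : B.-tuple bool -> R) : set ('cV[R]_d -> R) :=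
  [set f | exists N : relu_net R d,
     [/\ (net_size N <= W)%N, net_encodable dec N & f = net_eval N]].
Arguments relu_class {R} d W {B} dec.

Definition shatters (R : realType) (T : Type) (H : set (T -> R)) (n : nat)
  (x : 'I_n -> T) : Prop :=
  forall y : 'I_n -> R, (forall i, y i = 1 \/ y i = -1) ->
  exists2 h, H h & forall i, h (x i) = y i.

(* A shattered family is automatically injective, so its length is the number
   of shattered points; the supremum is +oo when these are unbounded. *)
Definition vc_dim (R : realType) (T : Type) (H : set (T -> R)) : \bar R :=
  ereal_sup [set (n%:R%:E : \bar R) | n in
    [set n : nat | exists x : 'I_n -> T, shatters H x]].

(* Main.v *)
(** A network with [W] edges is evaluated by a straight-line program with at
    most [4 W] instructions: only neurons with an outgoing edge matter, so there
    are at most [W] of them, however deep and wide the network is.  Each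
    instruction takes at most [2^B (d + W + 3)] values, whence at most
    [(2^B (d + W + 3))^(4 W)] functions, and [n] shattered points require [2^n]
    of them.  For [B = 0] all nonzero weights and biases have one common value
    and the outputs of all networks have the same sign, so that nothing is
    shattered; this covers the degenerate bound [0] at [B = 0], [W = 1]. *)
Require Import Defs.
From mathcomp Require Import all_boot all_order all_algebra.
From mathcomp Require Import all_classical all_reals all_analysis.
From mathcomp Require Import zify lra.
Set Implicit Arguments.
Unset Strict Implicit.
Unset Printing Implicit Defensive.
Import Order.TTheory GRing.Theory Num.Theory.
Local Open Scope ring_scope.

(** * Straight-line programs and their semantics *)

Section Programs.
Variables (R : realType) (d W B : nat) (dec : B.-tuple bool -> R).

(* [None] is the constant 1, [inl] an input coordinate, [inr] a neuron that has
   already been evaluated, in order of evaluation. *)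
Definition source := option ('I_d + 'I_W.+1).

(* [None] does nothing, [inl] applies the ReLU to the accumulator and stores the
   result as a new neuron, [inr] adds a weighted source to the accumulator. *)
Definition instr := option (unit + source * B.-tuple bool).

Definition source_val (x : 'cV[R]_d) (v : seq R) (s : source) : R :=
  match s with
  | None => 1
  | Some (inl i) => x i ord0
  | Some (inr j) => nth 0 v j
  end.

Definition step (x : 'cV[R]_d) (st : seq R * R) (op : instr) : seq R * R :=
  match op with
  | None => st
  | Some (inl _) => (rcons st.1 (relu st.2), 0)
  | Some (inr sw) => (st.1, st.2 + dec sw.2 * source_val x st.1 sw.1)
  end.

Definition run (x : 'cV[R]_d) (p : seq instr) (st : seq R * R) : seq R * R :=
  foldl (step x) st p.

Lemma run_cat (x : 'cV[R]_d) (p q : seq instr) (st : seq R * R) :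
  run x (p ++ q) st = run x q (run x p st).
Proof. exact: foldl_cat. Qed.

(** * Compilation of networks into programs *)

Lemma compile_term (a : R) (s : source) : encodable dec a ->
  exists2 p : seq instr, size p = (a != 0) &
    forall x v c, run x p (v, c) = (v, c + a * source_val x v s).
Proof.
move=> ea; have [->|a0] := eqVneq a 0.
  by exists [::] => // x v c; rewrite mul0r addr0.
case: ea => [a_eq0|[w aw]]; first by rewrite a_eq0 eqxx in a0.
by exists [:: Some (inr (s, w))] => // x v c; rewrite aw.
Qed.

(** Sources are only required to be correct where the coefficient is nonzero: neurons without
    outgoing edges are never evaluated, so their sources may be meaningless. *)
Lemma compile_sum (n : nat) (a : 'I_n -> R) (src : 'I_n -> source)
    (r : seq 'I_n) : (forall j, encodable dec (a j)) ->
  exists2 p : seq instr, size p = count (fun j => a j != 0) r &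
    forall x v c (z : 'I_n -> R),
      (forall j, a j != 0 -> source_val x v (src j) = z j) ->
      run x p (v, c) = (v, c + \sum_(j <- r) a j * z j).
Proof.
move=> ea; elim: r => [|j r [p sp runp]].
  by exists [::] => // x v c z _; rewrite big_nil addr0.
have [q sq runq] := compile_term (src j) (ea j).
exists (q ++ p); first by rewrite size_cat sq sp.
move=> x v c z Hz; rewrite run_cat runq (runp _ _ _ _ Hz) big_cons addrA.
have [->|aj0] := eqVneq (a j) 0; first by rewrite !mul0r.
by rewrite Hz.
Qed.

Lemma compile_neuron (n m : nat) (l : affine R n m) (i : 'I_m)
    (src : 'I_n -> source) : affine_encodable dec l ->
  exists2 p : seq instr,
    (size p <= #|[set j | weight l i j != 0%R]%SET|.+1)%N &
    forall x v (z : 'cV[R]_n),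
      (forall j, weight l i j != 0 -> source_val x v (src j) = z j ord0) ->
      run x p (v, 0) = (v, affine_eval l z i ord0).
Proof.
move=> [ew eb].
have [p sp runp] := compile_sum src (enum 'I_n) (ew i).
have [q sq runq] := compile_term None (eb i ord0).
exists (p ++ q).
  rewrite size_cat sp sq (leq_trans (leq_add (leqnn _) (leq_b1 _))) //.
  by rewrite addn1 ltnS cardsE cardE size_filter -enumT.
move=> x v z Hz; rewrite run_cat (runp _ _ _ (fun j => z j ord0) Hz) runq.
by rewrite big_enum add0r mulr1 /affine_eval !mxE.
Qed.

(** Each neuron costs its incoming edges, at most one instruction for the bias and one for the ReLU.
    The quantification over [u] is needed because memory grows while the layer is being
    evaluated. *)
Lemma compile_layer (n m : nat) (l : affine R n m) (r : seq 'I_m)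
    (src : 'I_n -> source) : affine_encodable dec l ->
  exists2 p : seq instr,
    (size p <= \sum_(i <- r) #|[set j | weight l i j != 0%R]%SET| + 2 * size r)%N &
    forall x v (z : 'cV[R]_n),
      (forall i j, weight l i j != 0 ->
         forall u, source_val x (v ++ u) (src j) = z j ord0) ->
      run x p (v, 0) = (v ++ [seq relu (affine_eval l z i ord0) | i <- r], 0).
Proof.
move=> el; elim: r => [|i r [p sp runp]].
  by exists [::] => // x v z _; rewrite cats0.
have [q sq runq] := compile_neuron i src el.
exists (q ++ Some (inl tt) :: p).
  move: sq sp; rewrite size_cat big_cons /=.
  by move: #|_| (bigop.body _ _ _) => e1 e2; lia.
move=> x v z Hz; rewrite run_cat (runq x v z) => [|j wij]; last first.
  by have := Hz i j wij [::]; rewrite cats0.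
rewrite -[LHS]/(run x p (rcons v _, 0)) (runp x _ z) ?cat_rcons //.
by move=> i' j wij u; rewrite cat_rcons; apply: Hz wij _.
Qed.

Lemma row_sizes_le (n m : nat) (l : affine R n m) (S : {set 'I_m}) :
  (\sum_(i <- enum S) #|[set j | weight l i j != 0%R]%SET| <= affine_size l)%N.
Proof.
rewrite big_enum_cond /= /affine_size -sum1_card.
rewrite (eq_bigl (fun ij => true && (weight l ij.1 ij.2 != 0))); last first.
  by move=> ij; rewrite inE.
rewrite -(pair_big_dep xpredT (fun i j => weight l i j != 0) (fun _ _ => 1%N)).
rewrite big_mkcond /=; apply: leq_sum => i _; case: ifP => // _.
by rewrite -sum1_card; under eq_bigl do rewrite inE.
Qed.

(** The neurons that [l] actually reads; only these have to be evaluated in the layer before. *)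
Definition sources_of (n m : nat) (l : affine R n m) : {set 'I_n} :=
  [set j | [exists i, weight l i j != 0]]%SET.

Lemma card_sources_of (n m : nat) (l : affine R n m) :
  (#|sources_of l| <= affine_size l)%N.
Proof.
apply: leq_trans (leq_imset_card snd _).
apply/subset_leq_card/fintype.subsetP => j; rewrite inE => /existsP[i wij].
by apply/imsetP; exists (i, j); rewrite ?inE.
Qed.

(* The cardinal of [S] is only bounded by [s] so that the induction hypothesis
   applies with [s] the number of edges of the next layer. *)
Lemma compile_hidden (m : nat) (h : hidden R d m) (S : {set 'I_m}) (s : nat) :
  hidden_encodable dec h -> (#|S| <= s)%N -> (hidden_size h + s <= W)%N ->
  exists p : seq instr, exists idx : 'I_m -> 'I_W.+1, exists k : nat,
    [/\ (size p <= 3 * hidden_size h + 2 * s)%N,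
        (k <= hidden_size h + s)%N &
        forall x, exists v, [/\ size v = k, run x p ([::], 0) = (v, 0) &
          forall i, i \in S ->
            forall u, nth 0 (v ++ u) (idx i) = hidden_eval h x i ord0]].
Proof.
(* A neuron of [T] is stored after the [k] earlier ones, at its rank in [enum T]; [k + t <= W] keeps
   [inord] faithful. *)
have idxP (n k t : nat) (T : {set 'I_n}) (v u : seq R) (f : 'I_n -> R) i :
    size v = k -> (#|T| <= t)%N -> (k + t <= W)%N -> i \in T ->
    nth 0 ((v ++ [seq f j | j <- enum T]) ++ u)
      (inord (k + index i (enum T)) : 'I_W.+1) = f i.
  move=> sv Tt kt iT.
  have iE : (index i (enum T) < #|T|)%N by rewrite cardE index_mem mem_enum.
  have it := leq_trans iE Tt.
  rewrite inordK; last by lia.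
  rewrite -catA nth_cat sv ltnNge leq_addr /= addKn nth_cat size_map -cardE iE.
  by rewrite (nth_map i) -?cardE // nth_index // mem_enum.
have layer_size (n m' t : nat) (l : affine R n m') (T : {set 'I_m'}) q :
    (#|T| <= t)%N ->
    (q <= \sum_(i <- enum T) #|[set j | weight l i j != 0%R]%SET| +
      2 * size (enum T))%N ->
    (q <= affine_size l + 2 * t)%N.
  move=> Tt /leq_trans; apply; rewrite leq_add ?row_sizes_le //.
  by rewrite -cardE leq_mul2l Tt.
elim: h S s => {m} [m l|n m h IH l] S s /=.
  move=> el Ss SW.
  have [p sp runp] := compile_layer (enum S) (fun j => Some (inl j)) el.
  exists p, (fun i => inord (0 + index i (enum S))), #|S|; split.
  - by have := layer_size _ _ _ _ _ _ Ss sp; lia.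
  - exact: leq_trans Ss (leq_addl _ _).
  move=> x; exists [seq relu (affine_eval l x i ord0) | i <- enum S].
  split; first by rewrite size_map -cardE.
    exact: runp.
  move=> i iS u; rewrite -[map _ _]cat0s.
  by rewrite (idxP _ 0%N s) ?mxE //; lia.
move=> [eh el] Ss SW.
(* The edges of [l] pay for the neurons it reads: each edge is charged once as an edge and at most
   twice for its source, whence the factor 3. *)
have [|p [idx [k [sp kS Hp]]]] := IH _ _ eh (card_sources_of l); first by lia.
have [q sq runq] := compile_layer (enum S) (fun j => Some (inr (idx j))) el.
exists (p ++ q), (fun i => inord (k + index i (enum S))), (k + #|S|)%N; split.
- by have := layer_size _ _ _ _ _ _ Ss sq; rewrite size_cat; lia.
- exact: leq_add.
move=> x; have [v [sv runp Hv]] := Hp x.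
exists (v ++ [seq relu (affine_eval l (hidden_eval h x) i ord0) | i <- enum S]).
split; first by rewrite size_cat size_map -cardE sv.
  rewrite run_cat runp; apply: runq => i j wij u.
  by apply: Hv; rewrite inE; apply/existsP; exists i.
by move=> i iS u; rewrite (idxP _ k s) ?mxE //; lia.
Qed.

Lemma compile_net (N : relu_net R d) : (0 < W)%N ->
  (net_size N <= W)%N -> net_encodable dec N ->
  exists p : (4 * W).-tuple instr,
    forall x, net_eval N x = (run x p ([::], 0)).2.
Proof.
case: N => m h o W0; rewrite /net_size /net_encodable /= => NW [eh eo].
have [p [idx [k [sp kS Hp]]]] := compile_hidden eh (card_sources_of o) NW.
have [q sq runq] := compile_neuron ord0 (fun j => Some (inr (idx j))) eo.
have row_le : (#|[set j | weight o ord0 j != 0%R]%SET| <= affine_size o)%N.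
  have := row_sizes_le o [set ord0]%SET.
  by rewrite enum_set1 big_seq1.
(* Padding with idle instructions gives all programs the same length. The real length is at most
   [3 * W + 1], the 1 being the output bias, and [W > 0]. *)
pose t := nseq (4 * W - size (p ++ q)) (None : instr) ++ p ++ q.
have st : size t == (4 * W)%N.
  by rewrite size_cat size_nseq subnK // size_cat; lia.
exists (Tuple st) => x; rewrite /= run_cat.
have -> (k' : nat) st' : run x (nseq k' None) st' = st' by elim: k'.
have [v [sv runp Hv]] := Hp x.
rewrite run_cat runp (runq x v (hidden_eval h x)) //= => j wij.
rewrite -[v]cats0; apply: Hv.
by rewrite inE; apply/existsP; exists ord0.
Qed.

(** * Counting programs against labelings *)

Lemma card_instr_le : (0 < B)%N -> (#|{: instr}| <= 2 ^ B * (d + W + 3))%N.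
Proof.
move=> B0; rewrite card_option card_sum card_unit card_prod card_option card_sum.
rewrite !card_ord card_tuple card_bool.
(* The exact count is [2 + 2 ^ B * (d + W + 2)], so the bound amounts to [2 <= 2 ^ B]. *)
have : (2 ^ 1 <= 2 ^ B)%N by rewrite leq_exp2l.
by rewrite expn1; nia.
Qed.

(** Shattering makes the map from programs to sign patterns on the points surjective. *)
Lemma shattered_card (n : nat) (x : 'I_n -> 'cV[R]_d) : (0 < W)%N ->
  shatters (relu_class d W dec) x -> (2 ^ n <= #|{: instr}| ^ (4 * W))%N.
Proof.
move=> W0 sh; rewrite -card_tuple.
have -> : (2 ^ n)%N = #|{: {ffun 'I_n -> bool}}|.
  by rewrite card_ffun card_bool card_ord.
pose sgn (p : (4 * W).-tuple instr) : {ffun 'I_n -> bool} :=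
  [ffun i => 0 < (run (x i) p ([::], 0)).2].
apply: leq_trans (leq_image_card sgn _); apply/subset_leq_card/fintype.subsetP => y _.
have [|h [N [NW eN ->]] Ny] := sh (fun i => if y i then 1 else -1).
  by move=> i; case: (y i); [left | right].
have [p Hp] := compile_net W0 NW eN.
apply/fintype.imageP; exists p => //; apply/ffunP => i; rewrite ffunE -Hp Ny.
by case: (y i); rewrite ?ltr01 // ltr0N1.
Qed.

End Programs.

(** * The case of zero bits *)

Lemma hidden_eval_ge0 (R : realType) (d m : nat) (h : hidden R d m)
    (x : 'cV[R]_d) (i : 'I_m) : 0 <= hidden_eval h x i ord0.
Proof. by case: h i => [m' l|n m' h l] i; rewrite /= mxE le_max lexx. Qed.

(** Hidden values are nonnegative and the output weights and bias are 0 or the single decoded value,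
    whose sign rules out one of the labels 1 and -1. *)
Lemma shattered_no_bits (R : realType) (d W n : nat)
    (dec : 0.-tuple bool -> R) (x : 'I_n -> 'cV[R]_d) :
  shatters (relu_class d W dec) x -> n = 0%N.
Proof.
case: n x => // n x sh; pose c := dec [tuple].
have wE a : encodable dec a -> a = 0 \/ a = c.
  by case=> [|[w ->]]; [left | right; rewrite tuple0].
have [_ [Np [_ [_ [wp bp]] ->]] /(_ ord0) Np1] := sh (fun=> 1) (fun=> or_introl erefl).
have [_ [Nn [_ [_ [wn bn]] ->]] /(_ ord0) Nn1] := sh (fun=> -1) (fun=> or_intror erefl).
have [c0|c0] := lerP 0 c.
- suff : 0 <= net_eval Nn (x ord0) by rewrite Nn1 ler0N1.
  rewrite /net_eval /affine_eval !mxE addr_ge0 //; last first.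
    by case: (wE _ (bn ord0 ord0)) => ->.
  apply: sumr_ge0 => j _; apply: mulr_ge0; last exact: hidden_eval_ge0.
  by case: (wE _ (wn ord0 j)) => ->.
- suff : net_eval Np (x ord0) <= 0 by rewrite Np1 ler10.
  rewrite /net_eval /affine_eval !mxE -oppr_ge0 opprD addr_ge0 //; last first.
    by case: (wE _ (bp ord0 ord0)) => ->; rewrite oppr_ge0 // ltW.
  rewrite -sumrN; apply: sumr_ge0 => j _; rewrite -mulNr.
  apply: mulr_ge0; last exact: hidden_eval_ge0.
  by case: (wE _ (wp ord0 j)) => ->; rewrite oppr_ge0 // ltW.
Qed.

(** * From the count to the VC bound *)

Lemma log2_ge0 (R : realType) (k : nat) : (0 < k)%N -> 0 <= log2 (k%:R : R).
Proof.
by move=> k0; rewrite /log2 divr_ge0 // ln_ge0 // ?ler1n // (ler_nat R 1 2).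
Qed.

(** The factor [K] absorbs the input dimension, so that both regimes of [d] follow from one
    estimate. *)
Lemma vc_dim_relu_class_le (R : realType) (d W B K : nat)
    (dec : B.-tuple bool -> R) : (0 < W)%N -> (d + W + 3 <= W * K)%N ->
  (vc_dim (relu_class d W dec) <=
    (4 * (1 + log2 (K%:R : R)) *
       (W%:R * B%:R + W%:R * log2 (W%:R : R)))%:E)%E.
Proof.
move=> W0 WK; have K0 : (0 < K)%N by nia.
have lW := log2_ge0 R W0; have lK := log2_ge0 R K0.
apply: ge_ereal_sup => _ [n [x sh] <-]; rewrite lee_fin.
have [B0|B0] := posnP B.
  subst B; rewrite (shattered_no_bits sh).
  by rewrite mulr0 add0r; do 2 ?[apply: mulr_ge0 => //]; rewrite addr_ge0.
have count : (2 ^ n <= (2 ^ B * (W * K)) ^ (4 * W))%N.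
  apply: leq_trans (shattered_card W0 sh) _.
  rewrite leq_exp2r; last by lia.
  by apply: leq_trans (card_instr_le _ _ B0) _; rewrite leq_mul2l WK orbT.
have ln2 : 0 < ln (2 : R) by rewrite ln_gt0 // (ltr_nat R 1 2).
have lnE (k : nat) : ln (k%:R : R) = log2 k%:R * ln 2.
  by rewrite /log2 divfK ?gt_eqF.
have key : n%:R <= (4 * W)%:R * (B%:R + (log2 (W%:R : R) + log2 K%:R)).
  have := count; rewrite -(ler_nat R) -ler_ln ?posrE ?ltr0n; last 2 first.
  - by rewrite expn_gt0.
  - by rewrite expn_gt0 !muln_gt0 expn_gt0 W0 K0.
  have lnX (k e : nat) : (0 < k)%N ->
      ln ((k ^ e)%:R : R) = e%:R * ln (k%:R : R).
    by move=> k0; rewrite natrX lnXn ?ltr0n // mulr_natl.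
  have lnM' (k e : nat) : (0 < k)%N -> (0 < e)%N ->
      ln ((k * e)%:R : R) = ln (k%:R : R) + ln (e%:R : R).
    by move=> k0 e0; rewrite natrM lnM ?posrE ?ltr0n.
  rewrite lnX // lnX ?muln_gt0 ?expn_gt0 ?W0 //.
  rewrite lnM' ?muln_gt0 ?expn_gt0 ?W0 // lnX // lnM' // (lnE W) (lnE K).
  by rewrite -!mulrDl mulrA ler_pM2r.
apply: le_trans key _; rewrite natrM.
(* With [B >= 1] the stray [log2 K] is at most [B * log2 K], which the factor [1 + log2 K]
   covers. *)
have B1 : 1 <= (B%:R : R) by rewrite ler1n.
rewrite -!mulrA -[W%:R * B%:R + _]mulrDr ler_pM2l // mulrCA ler_pM2l ?ltr0n //.
by nra.
Qed.

(* For the class to have finite VC dimension uniformly in the input dimension d,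
   the constant must depend on d, or d must be bounded in terms of W. *)
Theorem theorem6p1 (R : realType) :
  (forall d : nat, exists C : R,
     forall (W B : nat) (dec : B.-tuple bool -> R), (0 < W)%N ->
     (vc_dim (relu_class d W dec) <=
        (C * (W%:R * B%:R + W%:R * log2 (W%:R : R)))%:E)%E) /\
  (exists C : R,
     forall (d W B : nat) (dec : B.-tuple bool -> R), (0 < W)%N -> (d <= W)%N ->
     (vc_dim (relu_class d W dec) <=
        (C * (W%:R * B%:R + W%:R * log2 (W%:R : R)))%:E)%E).
Proof.
split=> [d|].
(* As [W >= 1], [K = d + 4] works for fixed [d], and [K = 5] when [d <= W]. *)
- exists (4 * (1 + log2 ((d + 4)%:R : R))) => W B dec W0.
  by apply: vc_dim_relu_class_le => //; nia.
- exists (4 * (1 + log2 (5%:R : R))) => d W B dec W0 dW.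
  by apply: vc_dim_relu_class_le => //; lia.
Qed.
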